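(* Let $x$ be a number with $x^2-4x\neq0$ and let $\lambda=\frac12\left(x-2+\sqrt{x^2-4x}\right)$. Then for every nonnegative integer $m$, \[\overline{G}^{1,1}_{2m}(x)=\frac{\lambda^{2m+1}-1}{\lambda^m(\lambda-1)},\qquad \overline{G}^{1,1}_{2m+1}(x)=\frac{\lambda^{2m+2}-1}{\lambda^m(\lambda^2-1)},\] \[\overline{G}^{2,1}_{2m}(x)=\frac{\lambda^{2m}+1}{\lambda^m},\qquad \overline{G}^{2,1}_{2m+1}(x)=\frac{\lambda^{2m+1}+1}{\lambda^m(\lambda+1)}.\]
   Context: For positive reals $\alpha,\beta$, the sign-alternating Gibonacci polynomials are defined by $\overline{G}^{\alpha,\beta}_0(x)=\alpha$, $\overline{G}^{\alpha,\beta}_1(x)=\beta$, and $\overline{G}^{\alpha,\beta}_k(x)=x^{(k-1)\bmod 2}\,\overline{G}^{\alpha,\beta}_{k-1}(x)-\overline{G}^{\alpha,\beta}_{k-2}(x)$ for $k\ge2$. The case $(\alpha,\beta)=(1,1)$ gives the sign-alternating Fibonacci polynomials and $(\alpha,\beta)=(2,1)$ the sign-alternating Lucas polynomials. *)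

(* Defs.v *)
From mathcomp Require Import all_boot all_order all_algebra.
Set Implicit Arguments.
Unset Strict Implicit.
Unset Printing Implicit Defensive.
Import GRing.Theory.
Local Open Scope ring_scope.

(* Sign-alternating Gibonacci polynomials. The third case is the recurrence at
   index k.+2, whence the exponent (k.+2 - 1) mod 2 = k.+1 mod 2. The initial
   values, positive reals in the source, may lie in any coefficient ring. *)
Fixpoint altGibonacci (R : nzRingType) (alpha beta : R) (k : nat) : {poly R} :=
  match k with
  | 0 => alpha%:P
  | 1 => beta%:P
  | (k'.+1 as k1).+1 =>
      'X^(k1 %% 2) * altGibonacci alpha beta k1 - altGibonacci alpha beta k'
  end.

(* Main.v *)
Require Import Defs.
From mathcomp Require Import all_boot all_order all_algebra.
From mathcomp Require Import ring.
Import GRing.Theory Num.Theory.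
Local Open Scope ring_scope.

(** The number [lambda] is a root of [t^2 - (x - 2) t + 1], so
    [x = (lambda + 1)^2 / lambda], and two steps of the recurrence act on the
    even-indexed values with eigenvalues [lambda] and [lambda^-1]. Hence
    [G_(2m) = A lambda^m + B lambda^(-m)] and
    [G_(2m+1) = (A lambda^(m+1) + B lambda^(-m)) / (lambda + 1)], with [A], [B]
    fixed by the initial values: [A = lambda / (lambda - 1)],
    [B = - 1 / (lambda - 1)] for Fibonacci and [A = B = 1] for Lucas. *)

Lemma altGibonacciSS (R : nzRingType) (a b : R) (k : nat) :
  altGibonacci a b k.+2 =
  'X^(k.+1 %% 2) * altGibonacci a b k.+1 - altGibonacci a b k.
Proof. by []. Qed.

Lemma horner_altGibonacci_even (R : comNzRingType) (a b x : R) (m : nat) :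
  (altGibonacci a b (2 * m.+1)).[x] =
  x * (altGibonacci a b (2 * m + 1)).[x] - (altGibonacci a b (2 * m)).[x].
Proof.
rewrite mulnS add2n addn1 altGibonacciSS.
have -> : ((2 * m).+1 %% 2 = 1)%N by rewrite modn2 /= mul2n odd_double.
by rewrite !hornerE.
Qed.

Lemma horner_altGibonacci_odd (R : comNzRingType) (a b x : R) (m : nat) :
  (altGibonacci a b (2 * m.+1 + 1)).[x] =
  (altGibonacci a b (2 * m.+1)).[x] - (altGibonacci a b (2 * m + 1)).[x].
Proof.
rewrite mulnS add2n !addn1 altGibonacciSS.
have -> : ((2 * m).+2 %% 2 = 0)%N by rewrite modn2 /= mul2n odd_double.
by rewrite expr0 mul1r !hornerE.
Qed.

(** The initial values are the closed forms at [m = 0], so the base case is immediate. Both parities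
    go through one induction because each recurrence step mixes them. *)
Lemma altGibonacci_binet (F : fieldType) (x l A B : F) (m : nat) :
    l != 0 -> l + 1 != 0 -> x * l = (l + 1) ^+ 2 ->
  let G k := (altGibonacci (A + B) ((A * l + B) / (l + 1)) k).[x] in
  G (2 * m)%N = A * l ^+ m + B / l ^+ m /\
  G (2 * m + 1)%N = (A * l ^+ m.+1 + B / l ^+ m) / (l + 1).
Proof.
move=> l0 l1 xl G; rewrite {}/G.
have {xl} -> : x = (l + 1) ^+ 2 / l by rewrite -xl mulfK.
elim: m => [|m [IHe IHo]].
  by rewrite muln0 /= !hornerC !expr0 expr1 !divr1 !mulr1.
have t0 : l ^+ m != 0 by rewrite expf_neq0.
rewrite horner_altGibonacci_odd horner_altGibonacci_even IHe IHo !exprS.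
(* With [l ^+ m] abstracted to a nonzero [t], both goals are rational identities in [A], [B], [l],
   [t]. *)
move: (l ^+ m) t0 => t t0.
by split; field; rewrite ?l0 ?l1 ?t0.
Qed.

Theorem corollary3p2 (C : numClosedFieldType) (x s : C)
    (hx : x ^+ 2 - 4%:R * x != 0)
    (hs : s ^+ 2 = x ^+ 2 - 4%:R * x) (m : nat) :
  let lambda := 2%:R^-1 * (x - 2%:R + s) in
  [/\ (altGibonacci 1 1 (2 * m)).[x]
        = (lambda ^+ (2 * m + 1) - 1) / (lambda ^+ m * (lambda - 1)),
      (altGibonacci 1 1 (2 * m + 1)).[x]
        = (lambda ^+ (2 * m + 2) - 1) / (lambda ^+ m * (lambda ^+ 2 - 1)),
      (altGibonacci 2%:R 1 (2 * m)).[x]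
        = (lambda ^+ (2 * m) + 1) / lambda ^+ m
    & (altGibonacci 2%:R 1 (2 * m + 1)).[x]
        = (lambda ^+ (2 * m + 1) + 1) / (lambda ^+ m * (lambda + 1))].
Proof.
set l := 2%:R^-1 * _; move=> lambda; rewrite {}/lambda.
have xl : x * l = (l + 1) ^+ 2.
  have n2 : 2%:R != 0 :> C by rewrite pnatr_eq0.
  have s_l : s = 2%:R * l - x + 2%:R by rewrite /l mulVKf //; ring.
  (* Since [s = 2 l - x + 2], four times [x * l - (l + 1) ^+ 2] is the opposite of
     [s ^+ 2 - (x ^+ 2 - 4 x)]; hence the factor 2 introduced twice. *)
  apply: (mulfI n2); apply: (mulfI n2); apply/eqP; rewrite -subr_eq0.
  move/eqP: hs; rewrite -subr_eq0 s_l => /eqP hs0.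
  by rewrite -oppr_eq0 -hs0; apply/eqP; ring.
clearbody l.
have l0 : l != 0.
  apply: contraTneq isT => l0; move/eqP: xl.
  by rewrite l0 mulr0 add0r expr1n eq_sym oner_eq0.
(* By [xl], [l = -1] would force [x = 0], and [l = 1] would force [x = 4]: the two roots of
   [x ^+ 2 - 4 x], excluded by [hx]. *)
have l1 : l + 1 != 0.
  apply: contraNneq hx => l1; move/eqP: xl.
  rewrite l1 expr0n /= mulf_eq0 (negPf l0) orbF => /eqP ->.
  by rewrite expr0n mulr0 subr0.
have lB1 : l - 1 != 0.
  apply: contraNneq hx => /subr0_eq l_1; move: xl; rewrite l_1 mulr1 => ->.
  by apply/eqP; ring.
have lsq : l ^+ 2 - 1 != 0 by rewrite subr_sqr_1 mulf_neq0.
have t0 : l ^+ m != 0 by rewrite expf_neq0.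
have [] := altGibonacci_binet _ _ _ (l / (l - 1)) (- (l - 1)^-1) m l0 l1 xl.
have -> : l / (l - 1) + - (l - 1)^-1 = 1 by field.
have -> : (l / (l - 1) * l + - (l - 1)^-1) / (l + 1) = 1.
  by field; rewrite l1 lB1.
have [] := altGibonacci_binet _ _ _ 1 1 m l0 l1 xl.
rewrite mul1r divff // -[1 + 1]/(2%:R) => -> -> -> ->.
rewrite mul2n -addnn !exprD (exprS l m).
move: (l ^+ m) t0 => t t0.
by split; field; rewrite ?l0 ?l1 ?lB1 ?lsq ?t0.
Qed.
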